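(* Every dominating function uniformly computes an ultrafilter base for the computable sets; in other words, $\mathcal{U}\le_s\mathrm{DomFcn}$.
   Context: For sets $A,B\subseteq\omega$, $A\subseteq^* B$ means $A\setminus B$ is finite; $\overline{R}=\omega\setminus R$. With $\langle\cdot,\cdot\rangle$ the usual computable Cantor pairing function on $\omega$, a set $X\subseteq\omega$ encodes the sequence $(X_n)_{n\in\omega}$ of its columns $X_n=\{u:\langle u,n\rangle\in X\}$. A set $F$ is an ultrafilter base (for the Boolean algebra of computable sets) if each $F_n$ is computable, $F_0=\omega$, for each $n$ we have $F_{n+1}\subseteq^* F_n$ and $F_n\setminus F_{n+1}$ is infinite, and for each computable set $R$ there is $n$ with $F_n\subseteq^* R$ or $F_n\subseteq^*\overline{R}$. $\mathcal{U}$ is the class of all such sets $F$. For $f,g\colon\omega\to\omega$, $g$ dominates $f$ if $g(n)\ge f(n)$ for all sufficiently large $n$. $\mathrm{DomFcn}$ is the class of functions $h\colon\omega\to\omega$ that dominate every computable function and satisfy $h(s)\ge s$ for all $s$. Medvedev reducibility between classes of functions on $\omega$ (sets are identified with characteristic functions): $\mathcal{C}\le_s\mathcal{D}$ if there is a Turing functional $\Theta$ such that $\Theta^g\in\mathcal{C}$ for each $g\in\mathcal{D}$. *)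

(* Defs.v *)
From Stdlib Require Import Arith Cantor Ensembles Finite_sets.

Notation class := ((nat -> nat) -> Prop).

Definition pair_nat (u n : nat) : nat := Cantor.to_nat (u, n).
Definition fst_nat (x : nat) : nat := fst (Cantor.of_nat x).
Definition snd_nat (x : nat) : nat := snd (Cantor.of_nat x).

(* Oracle computation is modelled by Kleene's partial recursive functions
   relative to an oracle g : nat -> nat.  All functions are unary; several
   arguments are passed through the Cantor pairing.  A Turing functional is
   given by a [code]. *)
Inductive code : Type :=
| Zero
| Succ
| Fst
| Snd
| Oracle
| Pair (c d : code)
| Comp (c d : code)
| Prec (c d : code)
| Mu (c : code).

(* [eval g c x y]: the computation of c with oracle g on input x halts with
   output y.
   - [Comp c d] runs d first.
   - [Prec c d] maps <a,0> to c(a) and <a,m+1> to d(<a,<m,r>>), where r is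
     the value at <a,m>.
   - [Mu c] maps x to the least y with c(<x,y>) = 0; all the values
     c(<x,m>) for m < y must be defined (and nonzero). *)
Fixpoint eval (g : nat -> nat) (c : code) (x y : nat) {struct c} : Prop :=
  match c with
  | Zero => y = 0
  | Succ => y = S x
  | Fst => y = fst_nat x
  | Snd => y = snd_nat x
  | Oracle => y = g x
  | Pair c d =>
      exists u v, eval g c x u /\ eval g d x v /\ y = pair_nat u v
  | Comp c d => exists u, eval g d x u /\ eval g c u y
  | Prec c d =>
      let a := fst_nat x in
      (fix rec (n r : nat) {struct n} : Prop :=
         match n with
         | 0 => eval g c a r
         | S m =>
             exists r', rec m r' /\ eval g d (pair_nat a (pair_nat m r')) r
         end) (snd_nat x) y
  | Mu c =>
      eval g c (pair_nat x y) 0 /\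
      forall m, m < y -> exists k, eval g c (pair_nat x m) (S k)
  end.

Lemma eval_functional (g : nat -> nat) (c : code) (x y z : nat) :
  eval g c x y -> eval g c x z -> y = z.
Proof.
revert x y z; induction c; simpl; intros x y z Hy Hz; try congruence.
- destruct Hy as (u & v & Hu & Hv & ->), Hz as (u' & v' & Hu' & Hv' & ->).
  rewrite (IHc1 _ _ _ Hu Hu'), (IHc2 _ _ _ Hv Hv'); reflexivity.
- destruct Hy as (u & Hu & Hy), Hz as (v & Hv & Hz).
  rewrite (IHc2 _ _ _ Hu Hv) in Hy; exact (IHc1 _ _ _ Hy Hz).
- revert y z Hy Hz; induction (snd_nat x) as [|n IHn]; intros y z Hy Hz.
  + exact (IHc1 _ _ _ Hy Hz).
  + destruct Hy as (u & Hu & Hy), Hz as (v & Hv & Hz).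
    rewrite (IHn _ _ Hu Hv) in Hy; exact (IHc2 _ _ _ Hy Hz).
- destruct Hy as [Hy Ly], Hz as [Hz Lz].
  destruct (Nat.lt_total y z) as [H | [H | H]]; [exfalso | exact H | exfalso].
  + destruct (Lz y H) as [k Hk]; discriminate (IHc _ _ _ Hy Hk).
  + destruct (Ly z H) as [k Hk]; discriminate (IHc _ _ _ Hz Hk).
Qed.

(* The functional Theta with oracle g is total and equal to f. *)
Definition computes (Theta : code) (g f : nat -> nat) : Prop :=
  forall x, eval g Theta x (f x).

Fixpoint oracle_free (c : code) : Prop :=
  match c with
  | Oracle => False
  | Pair c d | Comp c d | Prec c d => oracle_free c /\ oracle_free d
  | Mu c => oracle_free c
  | _ => True
  end.

(* For an oracle-free code the choice of the oracle is irrelevant. *)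
Definition computable (f : nat -> nat) : Prop :=
  exists c, oracle_free c /\ computes c (fun _ => 0) f.

Definition char_fun (X : Ensemble nat) (f : nat -> nat) : Prop :=
  forall x, (In nat X x /\ f x = 1) \/ (~ In nat X x /\ f x = 0).

Definition computable_set (R : Ensemble nat) : Prop :=
  exists f, computable f /\ char_fun R f.

Definition almost_included (A B : Ensemble nat) : Prop :=
  Finite nat (Setminus nat A B).

Definition column (X : Ensemble nat) (n : nat) : Ensemble nat :=
  fun u => In nat X (pair_nat u n).

Definition ultrafilter_base (F : Ensemble nat) : Prop :=
  (forall n, computable_set (column F n)) /\
  Same_set nat (column F 0) (Full_set nat) /\
  (forall n,
     almost_included (column F (S n)) (column F n) /\
     ~ Finite nat (Setminus nat (column F n) (column F (S n)))) /\
  (forall R, computable_set R ->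
     exists n, almost_included (column F n) R \/
               almost_included (column F n) (Complement nat R)).

(* The class U, its members being identified with their characteristic
   functions. *)
Definition UltrafilterBases : class :=
  fun f => exists F, ultrafilter_base F /\ char_fun F f.

Definition dominates (g f : nat -> nat) : Prop :=
  exists N, forall n, N <= n -> f n <= g n.

Definition DomFcn : class :=
  fun h => (forall f, computable f -> dominates h f) /\ (forall s, s <= h s).

Definition medvedev_le (C D : class) : Prop :=
  exists Theta : code, forall g, D g -> exists f, computes Theta g f /\ C f.

(* Main.v *)
From Stdlib Require Import Arith Bool Lia Cantor Ensembles Finite_sets.
From Stdlib Require Import Finite_sets_facts Classical ConstructiveEpsilon.
Require Import Defs.

(** Let [h] dominate every computable function.  The columns of the ultrafilter
base are built by recursion, [F_0] being everything and [F_(e+1)] being obtained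
from [F_e] in two moves.

Thinning: let [B] consist of every other element of [F_e].  This makes
[F_e \ F_(e+1)] infinite, whatever happens next.

Deciding: let [phi_e] be the [e]-th partial computable function.  If it is total,
[B] has to be cut down to [phi_e = 1] or to [phi_e <> 1], whichever keeps it
infinite; if it is partial, nothing should be done.  Both alternatives can be
guessed from [h], separately at each [u], in such a way that for fixed [e] all
but finitely many guesses are right:

- [phi_e] is taken to be total when its values at all [x <= u] converge within
  [h u] steps.  If it is total, the time needed for this is a computable function
  of [u], so that [h u] is eventually enough; if not, the test fails from the
  first point of divergence on.

- [B] is taken to meet [phi_e = 1] infinitely often when there is [v < u] in that
  intersection with [u <= h v].  If the intersection [C] is infinite, its next
  element after [v] is a computable function of [v], hence at most [h v] for
  large [v], and the last element of [C] below [u] is a witness.  If [C] is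
  finite, the values of [h] on [C] are bounded.

So each [F_(e+1)] agrees, up to a finite set, with a computable infinite set, and
is itself computable and infinite ([refine_eventually]).  The second guess looks
back, not ahead: membership of [u] in [F_(e+1)] thus needs [F_e] only up to [u],
and a table of [F_e] on [0..u] can be carried through the recursion on [e].  This
is why the construction is one functional of [h] ([decidable_tower]).

The list [phi_e] comes from a machine which interprets codes by small steps on a
stack held in a number.  All that is used about it is that it can be run
recursively for a given time, that halting persists, and that every computable
function is on the list ([recursive_run], [run_mono], [run_complete]). *)

(** * Recursive operators *)

Lemma fst_pair (u n : nat) : fst_nat (pair_nat u n) = u.
Proof. unfold fst_nat, pair_nat; now rewrite Cantor.cancel_of_to. Qed.

Lemma snd_pair (u n : nat) : snd_nat (pair_nat u n) = n.
Proof. unfold snd_nat, pair_nat; now rewrite Cantor.cancel_of_to. Qed.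

Lemma pair_fst_snd (x : nat) : pair_nat (fst_nat x) (snd_nat x) = x.
Proof.
unfold fst_nat, snd_nat, pair_nat.
rewrite <- surjective_pairing; apply Cantor.cancel_to_of.
Qed.

Lemma fst_zero : fst_nat 0 = 0.
Proof. reflexivity. Qed.

(* The unifier would otherwise unfold the pairing whenever two operators fail to
   match. *)
Opaque pair_nat fst_nat snd_nat.

(** The flag [o] tells whether the oracle may be queried, so that one set of
closure lemmas serves both for functionals of an oracle and for computable
functions. *)
Definition recursive (o : bool) (Phi : (nat -> nat) -> nat -> nat) : Prop :=
  exists c, (o = false -> oracle_free c) /\ forall g, computes c g (Phi g).

Lemma eval_oracle_free (g g' : nat -> nat) (c : code) (x y : nat) :
  oracle_free c -> eval g c x y -> eval g' c x y.
Proof.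
revert x y; induction c; simpl; intros x y Hc; try tauto.
- intros (u & v & Hu & Hv & ->); destruct Hc; exists u, v; auto.
- intros (u & Hu & Hy); destruct Hc; exists u; auto.
- revert y; induction (snd_nat x) as [|n IHn]; intros y; [destruct Hc; auto|].
  intros (r & Hr & Hy); destruct Hc; exists r; split; [now apply IHn | auto].
- intros [Hy Hlt]; split; [now apply IHc|].
  intros m Hm; destruct (Hlt m Hm) as [k Hk]; exists k; now apply IHc.
Qed.

Lemma computable_recursive (f : nat -> nat) :
  computable f <-> recursive false (fun _ => f).
Proof.
split.
- intros (c & Hc & Hf); exists c; split; [trivial|].
  intros g x; exact (eval_oracle_free _ _ _ _ _ Hc (Hf x)).
- intros (c & Hc & Hf); exists c; split; [auto|]; apply Hf.
Qed.

Section Closure.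

Variable o : bool.
Implicit Types a b n : (nat -> nat) -> nat -> nat.

Lemma recursive_ext a b :
  (forall g x, a g x = b g x) -> recursive o a -> recursive o b.
Proof.
intros E (c & Hc & Ha); exists c; split; [trivial|].
intros g x; rewrite <- E; apply Ha.
Qed.

Lemma recursive_id : recursive o (fun _ x => x).
Proof.
exists (Pair Fst Snd); split; [simpl; auto|].
intros g x; exists (fst_nat x), (snd_nat x); simpl.
rewrite pair_fst_snd; auto.
Qed.

Lemma recursive_comp a b :
  recursive o a -> recursive o b -> recursive o (fun g x => a g (b g x)).
Proof.
intros (c & Hc & Ha) (d & Hd & Hb); exists (Comp c d); split; [simpl; auto|].
intros g x; exists (b g x); split; [apply Hb | apply Ha].
Qed.

Lemma recursive_zero : recursive o (fun _ _ => 0).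
Proof. exists Zero; split; [simpl; auto|]; now intros g x. Qed.

Lemma recursive_S a : recursive o a -> recursive o (fun g x => S (a g x)).
Proof.
apply (recursive_comp (fun _ x => S x)).
exists Succ; split; [simpl; auto|]; now intros g x.
Qed.

Lemma recursive_const k : recursive o (fun _ _ => k).
Proof.
induction k; [apply recursive_zero | now apply (recursive_S (fun _ _ => k))].
Qed.

Lemma recursive_fst a : recursive o a -> recursive o (fun g x => fst_nat (a g x)).
Proof.
apply (recursive_comp (fun _ x => fst_nat x)).
exists Fst; split; [simpl; auto|]; now intros g x.
Qed.

Lemma recursive_snd a : recursive o a -> recursive o (fun g x => snd_nat (a g x)).
Proof.
apply (recursive_comp (fun _ x => snd_nat x)).
exists Snd; split; [simpl; auto|]; now intros g x.
Qed.

Lemma recursive_pair a b :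
  recursive o a -> recursive o b ->
  recursive o (fun g x => pair_nat (a g x) (b g x)).
Proof.
intros (c & Hc & Ha) (d & Hd & Hb); exists (Pair c d); split; [simpl; auto|].
intros g x; exists (a g x), (b g x); repeat split; [apply Ha | apply Hb].
Qed.

(** Closure under primitive recursion with parameter: the step is an operator of
the triple coding the parameter, the counter and the previous value. *)
Lemma recursive_rect a n (s : (nat -> nat) -> nat -> nat -> nat -> nat) :
  recursive o a -> recursive o n ->
  recursive o (fun g p =>
    s g (fst_nat p) (fst_nat (snd_nat p)) (snd_nat (snd_nat p))) ->
  recursive o (fun g x => nat_rect (fun _ => nat) (a g x) (s g x) (n g x)).
Proof.
intros (ca & Ha & Ea) Hn (cs & Hs & Es).
set (Phi := fun g x => nat_rect (fun _ => nat) (a g (fst_nat x))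
              (s g (fst_nat x)) (snd_nat x)).
assert (HPhi : recursive o Phi).
{ exists (Prec ca cs); split; [simpl; auto|].
  intros g x; unfold Phi; simpl.
  induction (snd_nat x) as [|m IHm]; simpl; [apply Ea|].
  eexists; split; [exact IHm|].
  match goal with |- eval _ _ ?z _ => pose proof (Es g z) as E end.
  cbv beta in E; now rewrite !snd_pair, !fst_pair in E. }
apply recursive_ext with (fun g x => Phi g (pair_nat x (n g x))).
- intros g x; unfold Phi; now rewrite fst_pair, snd_pair.
- apply recursive_comp; [exact HPhi|].
  now apply recursive_pair; [apply recursive_id|].
Qed.

(** Operators of two arguments are represented by their action on coded pairs;
this turns the representation back into composition. *)
Lemma recursive_subst (b : (nat -> nat) -> nat -> nat -> nat) a n :
  recursive o (fun g p => b g (fst_nat p) (snd_nat p)) ->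
  recursive o a -> recursive o n ->
  recursive o (fun g x => b g (a g x) (n g x)).
Proof.
intros Hb Ha Hn.
generalize (recursive_comp _ _ Hb (recursive_pair _ _ Ha Hn)).
apply recursive_ext; intros g x; cbv beta; now rewrite fst_pair, snd_pair.
Qed.

Lemma recursive_match a n (b : (nat -> nat) -> nat -> nat -> nat) :
  recursive o n -> recursive o a ->
  recursive o (fun g p => b g (fst_nat p) (snd_nat p)) ->
  recursive o (fun g x => match n g x with 0 => a g x | S m => b g x m end).
Proof.
intros Hn Ha Hb.
apply recursive_ext with
  (fun g x => nat_rect (fun _ => nat) (a g x) (fun m _ => b g x m) (n g x)).
- intros g x; now destruct (n g x).
- apply recursive_rect with (s := fun g x m _ => b g x m); trivial.
  apply recursive_subst with (a := fun _ x => fst_nat x)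
    (n := fun _ x => fst_nat (snd_nat x)); [exact Hb | |];
    repeat (apply recursive_fst || apply recursive_snd); apply recursive_id.
Qed.

(** Minimization, for searches that always succeed: the operator is given by its
specification, because there is no total search function to write down. *)
Lemma recursive_min a (m : (nat -> nat) -> nat -> nat) :
  recursive o a ->
  (forall g x, a g (pair_nat x (m g x)) = 0) ->
  (forall g x y, y < m g x -> a g (pair_nat x y) <> 0) ->
  recursive o m.
Proof.
intros (c & Hc & Ha) H0 Hlt; exists (Mu c); split; [simpl; auto|].
intros g x; split; [rewrite <- (H0 g x); apply Ha|].
intros y Hy; specialize (Hlt g x y Hy).
destruct (a g (pair_nat x y)) as [|k] eqn:E; [easy|].
exists k; rewrite <- E; apply Ha.
Qed.

End Closure.

Lemma recursive_oracle a :
  recursive true a -> recursive true (fun g x => g (a g x)).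
Proof.
apply (recursive_comp true (fun g x => g x)).
exists Oracle; split; [discriminate|]; now intros g x.
Qed.

Definition decidable (o : bool) (P : (nat -> nat) -> nat -> bool) : Prop :=
  recursive o (fun g x => Nat.b2n (P g x)).

Section DecidableClosure.

Variable o : bool.
Implicit Types a b n : (nat -> nat) -> nat -> nat.
Implicit Types P Q : (nat -> nat) -> nat -> bool.

Lemma decidable_ext P Q :
  (forall g x, P g x = Q g x) -> decidable o P -> decidable o Q.
Proof. intros E; apply recursive_ext; intros g x; now rewrite E. Qed.

Lemma recursive_if P a b :
  decidable o P -> recursive o a -> recursive o b ->
  recursive o (fun g x => if P g x then a g x else b g x).
Proof.
intros HP Ha Hb.
apply recursive_ext with
  (fun g x => match Nat.b2n (P g x) with 0 => b g x | S _ => a g x end).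
- intros g x; now destruct (P g x).
- apply recursive_match with (b := fun g x _ => a g x); trivial.
  apply (recursive_comp o a (fun _ p => fst_nat p)); [trivial|].
  apply recursive_fst, recursive_id.
Qed.

Lemma decidable_const (k : bool) : decidable o (fun _ _ => k).
Proof. exact (recursive_const o (Nat.b2n k)). Qed.

Lemma decidable_if P Q R :
  decidable o P -> decidable o Q -> decidable o R ->
  decidable o (fun g x => if P g x then Q g x else R g x).
Proof.
intros HP HQ HR.
apply recursive_ext with (2 := recursive_if _ _ _ HP HQ HR).
intros g x; now destruct (P g x).
Qed.

Lemma decidable_op (op : bool -> bool -> bool) P Q :
  decidable o P -> decidable o Q ->
  decidable o (fun g x => op (P g x) (Q g x)).
Proof.
intros HP HQ.
apply decidable_ext with (fun g x =>
  if P g x then if Q g x then op true true else op true false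
  else if Q g x then op false true else op false false).
- intros g x; now destruct (P g x), (Q g x).
- repeat apply decidable_if; trivial; apply decidable_const.
Qed.

Lemma decidable_neg P : decidable o P -> decidable o (fun g x => negb (P g x)).
Proof.
intros HP; apply decidable_ext with (fun g x => if P g x then false else true).
- now intros g x; destruct (P g x).
- apply decidable_if; trivial; apply decidable_const.
Qed.

Lemma decidable_is_zero a :
  recursive o a -> decidable o (fun g x => a g x =? 0).
Proof.
intros Ha.
apply recursive_ext with (fun g x => match a g x with 0 => 1 | S _ => 0 end).
- intros g x; now destruct (a g x).
- apply recursive_match with (b := fun _ _ _ => 0); trivial;
    apply recursive_const.
Qed.

Lemma recursive_sub a b :
  recursive o a -> recursive o b -> recursive o (fun g x => a g x - b g x).
Proof.
intros Ha Hb.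
apply recursive_ext with (fun g x =>
  nat_rect (fun _ => nat) (a g x)
    (fun _ r => match r with 0 => 0 | S k => k end) (b g x)).
- intros g x; induction (b g x) as [|k IHk]; simpl; [lia|].
  rewrite IHk; destruct (a g x - k) eqn:E; lia.
- apply recursive_rect with
    (s := fun _ _ _ r => match r with 0 => 0 | S k => k end); trivial.
  apply recursive_match with (b := fun _ _ k => k);
    repeat apply recursive_snd; try apply recursive_const; apply recursive_id.
Qed.

Lemma decidable_leb a b :
  recursive o a -> recursive o b -> decidable o (fun g x => a g x <=? b g x).
Proof.
intros Ha Hb; apply decidable_ext with (fun g x => a g x - b g x =? 0).
- intros g x; destruct (Nat.leb_spec (a g x) (b g x));
    [apply Nat.eqb_eq | apply Nat.eqb_neq]; lia.
- now apply decidable_is_zero, recursive_sub.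
Qed.

Lemma decidable_eqb a b :
  recursive o a -> recursive o b -> decidable o (fun g x => a g x =? b g x).
Proof.
intros Ha Hb.
apply decidable_ext with (fun g x => (a g x <=? b g x) && (b g x <=? a g x)).
- intros g x; apply eq_true_iff_eq.
  rewrite andb_true_iff, !Nat.leb_le, Nat.eqb_eq; lia.
- now apply decidable_op; apply decidable_leb.
Qed.

Lemma decidable_subst (P : (nat -> nat) -> nat -> nat -> bool) a b :
  decidable o (fun g p => P g (fst_nat p) (snd_nat p)) ->
  recursive o a -> recursive o b ->
  decidable o (fun g x => P g (a g x) (b g x)).
Proof. exact (recursive_subst o (fun g x y => Nat.b2n (P g x y)) a b). Qed.

End DecidableClosure.

(** Bounded quantifiers and the parity of a bounded count are the same recursion
with different connectives. *)
Definition fold_below (op : bool -> bool -> bool) (b : bool) (P : nat -> bool)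
    (n : nat) : bool :=
  nat_rect (fun _ => bool) b (fun i r => op (P i) r) n.

Definition exists_below := fold_below orb false.
Definition forall_below := fold_below andb true.
Definition even_below := fold_below xorb true.

Lemma exists_belowP (P : nat -> bool) (n : nat) :
  exists_below P n = true <-> exists i, i < n /\ P i = true.
Proof.
induction n as [|n IHn]; simpl; [split; [easy | intros (i & Hi & _); lia]|].
unfold exists_below in *; simpl; rewrite orb_true_iff, IHn; split.
- intros [H | (i & Hi & H)]; [exists n | exists i]; auto with arith.
- intros (i & Hi & H); destruct (Nat.eq_dec i n) as [-> | Hn]; [now left|].
  right; exists i; split; [lia | trivial].
Qed.

Lemma forall_belowP (P : nat -> bool) (n : nat) :
  forall_below P n = true <-> forall i, i < n -> P i = true.
Proof.
induction n as [|n IHn]; simpl; [split; [intros _ i Hi; lia | easy]|].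
unfold forall_below in *; simpl; rewrite andb_true_iff, IHn; split.
- intros [H H'] i Hi; destruct (Nat.eq_dec i n) as [-> | Hn]; [trivial|].
  apply H'; lia.
- intros H; split; [|intros i Hi]; apply H; lia.
Qed.

Lemma fold_below_ext op b (P Q : nat -> bool) (n : nat) :
  (forall i, i < n -> P i = Q i) -> fold_below op b P n = fold_below op b Q n.
Proof.
intros H; induction n as [|n IHn]; simpl; [trivial|].
rewrite H, IHn; auto with arith.
Qed.

Lemma decidable_fold o op b (P : (nat -> nat) -> nat -> nat -> bool) n :
  decidable o (fun g p => P g (fst_nat p) (snd_nat p)) ->
  recursive o n ->
  decidable o (fun g x => fold_below op b (P g x) (n g x)).
Proof.
intros HP Hn.
apply recursive_ext with (fun g x =>
  nat_rect (fun _ => nat) (Nat.b2n b)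
    (fun i r => Nat.b2n (op (P g x i) (r =? 1))) (n g x)).
- intros g x; induction (n g x) as [|k IHk]; simpl; [trivial|].
  rewrite IHk; now destruct (fold_below op b (P g x) k).
- apply recursive_rect with
    (s := fun g x i r => Nat.b2n (op (P g x i) (r =? 1))); trivial.
  + apply recursive_const.
  + apply decidable_op with (P := fun g p => P g (fst_nat p) (fst_nat (snd_nat p)))
      (Q := fun _ p => snd_nat (snd_nat p) =? 1).
    * apply decidable_subst with (P := P); [trivial | |];
        repeat (apply recursive_fst || apply recursive_snd); apply recursive_id.
    * apply decidable_eqb; [|apply recursive_const].
      repeat apply recursive_snd; apply recursive_id.
Qed.

Ltac rec_tac :=
  repeat first
    [ assumption
    | apply recursive_id | apply recursive_const
    | apply recursive_fst | apply recursive_snd | apply recursive_pair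
    | apply recursive_S | apply recursive_oracle | apply recursive_sub
    | apply recursive_match
    | apply decidable_const
    | apply (decidable_op _ andb) | apply (decidable_op _ eqb)
    | apply decidable_neg | apply decidable_if
    | apply decidable_eqb | apply decidable_leb
    | apply decidable_fold
    | match goal with
      | H : decidable _ (fun g p => ?P g (fst_nat p) (snd_nat p)) |- _ =>
          apply (decidable_subst _ P); [exact H | |]
      end ].

(** * A universal machine *)

(** A state of the machine is a pair of a stack [K] of instructions and a current
value [v]; an instruction is a pair of a tag and data [d], and the empty stack is
0. *)
Definition push (tag d K : nat) : nat := pair_nat (pair_nat tag d) K.

(** Tags 1 to 8 are the constructors of [code] other than [Oracle], the data being
the numbers of the subcodes.  Tags 9 to 11 are continuations:
- 9 holds [d] and [x]; it saves the value [v] of the first component of a pair and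
  runs [d] on [x];
- 10 holds [u] and replaces [v] by the pair of [u] and [v];
- 11 holds [c] and a pair of [x] and [i]; it stops a minimization at [i] if
  [v = 0] and otherwise tries [i + 1].

Tag 7 on input <a, m+1> computes the value [r] at <a, m> and lets two instructions
of tag 10 rebuild <a, <m, r>>.  Tag 0 is what is read from the empty stack; it
leaves the state alone, so that halting persists. *)
Definition instr (tag d K v : nat) : nat :=
  match tag with
  | 0 => pair_nat 0 v
  | 1 => pair_nat K 0
  | 2 => pair_nat K (S v)
  | 3 => pair_nat K (fst_nat v)
  | 4 => pair_nat K (snd_nat v)
  | 5 => pair_nat (pair_nat (fst_nat d) (push 9 (pair_nat (snd_nat d) v) K)) v
  | 6 => pair_nat (pair_nat (snd_nat d) (pair_nat (fst_nat d) K)) v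
  | 7 =>
      match snd_nat v with
      | 0 => pair_nat (pair_nat (fst_nat d) K) (fst_nat v)
      | S m =>
          pair_nat
            (push 7 d (push 10 m (push 10 (fst_nat v) (pair_nat (snd_nat d) K))))
            (pair_nat (fst_nat v) m)
      end
  | 8 => pair_nat (pair_nat d (push 11 (pair_nat d (pair_nat v 0)) K)) (pair_nat v 0)
  | 9 => pair_nat (pair_nat (fst_nat d) (push 10 v K)) (snd_nat d)
  | 10 => pair_nat K (pair_nat d v)
  | _ =>
      match v with
      | 0 => pair_nat K (snd_nat (snd_nat d))
      | S _ =>
          let d' := pair_nat (fst_nat (snd_nat d)) (S (snd_nat (snd_nat d))) in
          pair_nat (pair_nat (fst_nat d) (push 11 (pair_nat (fst_nat d) d') K)) d'
      end
  end.

Definition step (s : nat) : nat :=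
  instr (fst_nat (fst_nat (fst_nat s))) (snd_nat (fst_nat (fst_nat s)))
    (snd_nat (fst_nat s)) (snd_nat s).

(** 0 if the [e]-th function has not converged at [x] after [t] steps, and one more
than its value otherwise. *)
Definition run (e x t : nat) : nat :=
  let s := Nat.iter t step (pair_nat (pair_nat e 0) x) in
  match fst_nat s with 0 => S (snd_nat s) | S _ => 0 end.

Lemma recursive_step o a : recursive o a -> recursive o (fun g x => step (a g x)).
Proof.
apply (recursive_comp o (fun _ x => step x)).
unfold step, instr, push; cbv zeta; rec_tac.
Qed.

Lemma recursive_run o e x t :
  recursive o e -> recursive o x -> recursive o t ->
  recursive o (fun g z => run (e g z) (x g z) (t g z)).
Proof.
intros He Hx Ht.
assert (Hs : recursive o (fun g z =>
  Nat.iter (t g z) step (pair_nat (pair_nat (e g z) 0) (x g z)))).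
{ apply recursive_rect with (s := fun _ _ _ r => step r);
    try apply recursive_step; rec_tac. }
unfold run; cbv zeta.
apply recursive_match with (b := fun _ _ _ => 0); [| apply recursive_S |];
  rec_tac.
Qed.

Fixpoint number (c : code) : nat :=
  match c with
  (* a dummy: only oracle-free codes are run *)
  | Oracle => pair_nat 0 0
  | Zero => pair_nat 1 0
  | Succ => pair_nat 2 0
  | Fst => pair_nat 3 0
  | Snd => pair_nat 4 0
  | Pair c d => pair_nat 5 (pair_nat (number c) (number d))
  | Comp c d => pair_nat 6 (pair_nat (number c) (number d))
  | Prec c d => pair_nat 7 (pair_nat (number c) (number d))
  | Mu c => pair_nat 8 (number c)
  end.

Definition reaches (s s' : nat) : Prop := exists t, Nat.iter t step s = s'.

Lemma reaches_refl s : reaches s s.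
Proof. now exists 0. Qed.

Lemma reaches_trans s s' s'' : reaches s s' -> reaches s' s'' -> reaches s s''.
Proof.
intros [t Ht] [t' Ht']; exists (t' + t); now rewrite Nat.iter_add, Ht.
Qed.

Lemma reaches_step tag d K v s :
  reaches (instr tag d K v) s -> reaches (pair_nat (push tag d K) v) s.
Proof.
apply reaches_trans; exists 1; unfold step, push; simpl.
now rewrite !fst_pair, !snd_pair.
Qed.

Ltac machine_step := apply reaches_step; simpl; rewrite ?fst_pair, ?snd_pair, ?fst_pair.

(** The stack [K] is arbitrary so that the induction hypotheses apply to subcodes,
which are run above continuations. *)
Lemma machine_complete (g : nat -> nat) (c : code) (x y K : nat) :
  oracle_free c -> eval g c x y ->
  reaches (pair_nat (pair_nat (number c) K) x) (pair_nat K y).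
Proof.
revert x y K; induction c; simpl; intros x y K Hc.
- intros ->; machine_step; apply reaches_refl.
- intros ->; machine_step; apply reaches_refl.
- intros ->; machine_step; apply reaches_refl.
- intros ->; machine_step; apply reaches_refl.
- easy.
- intros (u & v & Hu & Hv & ->); destruct Hc as [Hc1 Hc2]; machine_step.
  eapply reaches_trans; [exact (IHc1 _ _ _ Hc1 Hu)|]; machine_step.
  eapply reaches_trans; [exact (IHc2 _ _ _ Hc2 Hv)|]; machine_step.
  apply reaches_refl.
- intros (u & Hu & Hy); destruct Hc as [Hc1 Hc2]; machine_step.
  eapply reaches_trans; [exact (IHc2 _ _ _ Hc2 Hu)|].
  now apply IHc1.
- destruct Hc as [Hc1 Hc2]; rewrite <- (pair_fst_snd x) at 2.
  generalize (fst_nat x) as a; intros a; revert y K.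
  induction (snd_nat x) as [|m IHm]; intros y K.
  + intros Hy; machine_step; now apply IHc1.
  + intros (r & Hr & Hy); machine_step.
    eapply reaches_trans; [exact (IHm _ _ Hr)|].
    do 2 machine_step; now apply IHc2.
- intros [Hy Hlt]; machine_step.
  (* [k] counts the trials that remain when [i] is tried *)
  assert (Hloop : forall k i, k + i = y -> reaches
    (pair_nat (pair_nat (number c)
       (push 11 (pair_nat (number c) (pair_nat x i)) K)) (pair_nat x i))
    (pair_nat K y)); [|now apply (Hloop y 0), Nat.add_0_r].
  induction k as [|k IHk]; intros i Hi.
  + simpl in Hi; subst i; eapply reaches_trans; [exact (IHc _ _ _ Hc Hy)|].
    machine_step; apply reaches_refl.
  + destruct (Hlt i) as [w Hw]; [lia|].
    eapply reaches_trans; [exact (IHc _ _ _ Hc Hw)|]; machine_step.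
    apply IHk; lia.
Qed.


Lemma iter_step_halted t x : Nat.iter t step (pair_nat 0 x) = pair_nat 0 x.
Proof.
induction t as [|t IHt]; simpl; [trivial|]; rewrite IHt.
unfold step; now rewrite fst_pair, snd_pair, !fst_zero.
Qed.

Lemma run_mono e x t t' : run e x t <> 0 -> t <= t' -> run e x t' = run e x t.
Proof.
intros Ht Hle; replace t' with ((t' - t) + t) by lia.
unfold run in *; rewrite Nat.iter_add.
destruct (fst_nat (Nat.iter t step _)) as [|k] eqn:E; [|easy].
rewrite <- (pair_fst_snd (Nat.iter t step _)), E, iter_step_halted.
now rewrite fst_pair, !snd_pair.
Qed.

Definition total (e : nat) : Prop := forall x, exists t, run e x t <> 0.

Lemma run_complete f :
  computable f -> exists e, forall x, exists t, run e x t = S (f x).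
Proof.
intros (c & Hc & Hf); exists (number c); intros x.
destruct (machine_complete _ c x (f x) 0 Hc (Hf x)) as [t Ht].
exists t; unfold run; now rewrite Ht, fst_pair, snd_pair.
Qed.

(** * The construction *)

(** Every other element of [A], starting with the first. *)
Definition thin (A : nat -> bool) (u : nat) : bool := A u && even_below A u.

Definition halts_upto (e u t : nat) : bool :=
  forall_below (fun x => negb (run e x t =? 0)) (S u).

(** The value found is 1, see [run]. *)
Definition accepts (e x t : nat) : bool := run e x t =? 2.

(** The guess that infinitely many elements of [thin A] are accepted: at [u] the
wait for the next one has not outlasted the bound that [h] sets at some earlier
one. *)
Definition recently_accepted (h : nat -> nat) (e : nat) (A : nat -> bool)
    (u : nat) : bool :=
  exists_below (fun v => thin A v && accepts e v (h v) && (u <=? h v)) u.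

(** The passage from [F_e] to [F_(e+1)]. *)
Definition refine (h : nat -> nat) (e : nat) (A : nat -> bool) (u : nat) : bool :=
  thin A u &&
  (if halts_upto e u (h u)
   then eqb (accepts e u (h u)) (recently_accepted h e A u)
   else true).

Fixpoint tower (h : nat -> nat) (n : nat) : nat -> bool :=
  match n with
  | 0 => fun _ => true
  | S e => refine h e (tower h e)
  end.

(** * The construction is uniformly recursive in the oracle *)

Lemma decidable_thin o A a :
  decidable o (fun g p => A g (fst_nat p) (snd_nat p)) -> recursive o a ->
  decidable o (fun g x => thin (A g x) (a g x)).
Proof.
intros HA Ha; unfold thin, even_below; rec_tac.
Qed.

Lemma decidable_halts_upto o e u t :
  recursive o e -> recursive o u -> recursive o t ->
  decidable o (fun g x => halts_upto (e g x) (u g x) (t g x)).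
Proof.
intros He Hu Ht; unfold halts_upto, forall_below.
apply decidable_fold with
  (P := fun g x i => negb (run (e g x) i (t g x) =? 0)); [|rec_tac].
apply decidable_neg, decidable_eqb; [|rec_tac].
apply recursive_run; rec_tac.
- apply (recursive_comp o e (fun _ p => fst_nat p)); rec_tac.
- apply (recursive_comp o t (fun _ p => fst_nat p)); rec_tac.
Qed.

Lemma decidable_accepts o e u t :
  recursive o e -> recursive o u -> recursive o t ->
  decidable o (fun g x => accepts (e g x) (u g x) (t g x)).
Proof.
intros He Hu Ht; unfold accepts.
apply decidable_eqb; [now apply recursive_run | rec_tac].
Qed.

Lemma decidable_refine A e a :
  decidable true (fun g p => A g (fst_nat p) (snd_nat p)) ->
  recursive true e -> recursive true a ->
  decidable true (fun g x => refine g (e g x) (A g x) (a g x)).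
Proof.
intros HA He Ha; unfold refine, recently_accepted, exists_below.
apply decidable_op; [now apply decidable_thin|].
apply decidable_if; [|apply decidable_op|apply decidable_const].
- apply decidable_halts_upto; rec_tac.
- apply decidable_accepts; rec_tac.
- assert (He' : recursive true (fun g p => e g (fst_nat p)))
    by (apply (recursive_comp true e (fun _ p => fst_nat p)); rec_tac).
  assert (Ha' : recursive true (fun g p => a g (fst_nat p)))
    by (apply (recursive_comp true a (fun _ p => fst_nat p)); rec_tac).
  apply decidable_fold with (P := fun g x v =>
    thin (A g x) v && accepts (e g x) v (g v) && (a g x <=? g v)); [|rec_tac].
  apply decidable_op; [apply decidable_op|].
  + apply decidable_thin with (A := fun g p => A g (fst_nat p)); [|rec_tac].
    apply decidable_subst with (P := A); rec_tac.
  + apply decidable_accepts; rec_tac.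
  + apply decidable_leb; rec_tac.
Qed.

(** The values of [f] below [w] as a nested list, the last one in front. *)
Definition table (f : nat -> bool) (w : nat) : nat :=
  nat_rect (fun _ => nat) 0 (fun i r => pair_nat (Nat.b2n (f i)) r) w.

Definition lookup (w t q : nat) : bool :=
  fst_nat (Nat.iter (w - S q) snd_nat t) =? 1.

Lemma lookup_table f w q : q < w -> lookup w (table f w) q = f q.
Proof.
unfold lookup; induction w as [|w IHw]; [lia|]; intros Hq.
destruct (Nat.eq_dec q w) as [-> | Hn].
- rewrite Nat.sub_diag; simpl; rewrite fst_pair; now destruct (f w).
- replace (S w - S q) with (S (w - S q)) by lia.
  rewrite Nat.iter_succ_r; simpl table; rewrite snd_pair; apply IHw; lia.
Qed.

(** [tower] recurses on [n] through values that are functions; restricting these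
functions to [0..u], which [refine_ext_below] permits, makes the values numbers and
the recursion primitive. *)
Definition tower_table (h : nat -> nat) (u n : nat) : nat :=
  nat_rect (fun _ => nat) (table (fun _ => true) (S u))
    (fun e t => table (refine h e (lookup (S u) t)) (S u)) n.

Lemma refine_ext_below h e A B u :
  (forall v, v <= u -> A v = B v) -> refine h e A u = refine h e B u.
Proof.
intros HAB.
assert (Hthin : forall v, v <= u -> thin A v = thin B v).
{ intros v Hv; unfold thin, even_below; f_equal; [now apply HAB|].
  apply fold_below_ext; intros i Hi; apply HAB; lia. }
unfold refine; rewrite Hthin by lia; do 2 f_equal.
destruct halts_upto; [f_equal|trivial].
apply fold_below_ext; intros v Hv; rewrite Hthin by lia; trivial.
Qed.

Lemma tower_table_spec h u n v :
  v <= u -> lookup (S u) (tower_table h u n) v = tower h n v.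
Proof.
revert v; induction n as [|n IHn]; intros v Hv.
- apply (lookup_table (fun _ => true)); lia.
- etransitivity; [apply lookup_table; lia|].
  apply refine_ext_below; intros w Hw; apply IHn; lia.
Qed.

Lemma recursive_table o f w :
  decidable o (fun g p => f g (fst_nat p) (snd_nat p)) -> recursive o w ->
  recursive o (fun g x => table (f g x) (w g x)).
Proof.
intros Hf Hw; apply recursive_rect with
  (s := fun g x i r => pair_nat (Nat.b2n (f g x i)) r); rec_tac.
Qed.

Lemma decidable_lookup o w t q :
  recursive o w -> recursive o t -> recursive o q ->
  decidable o (fun g x => lookup (w g x) (t g x) (q g x)).
Proof.
intros Hw Ht Hq; apply decidable_eqb; [|rec_tac].
apply recursive_fst.
apply recursive_rect with (s := fun _ _ _ r => snd_nat r); rec_tac.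
Qed.

Lemma decidable_tower :
  decidable true (fun g x => tower g (snd_nat x) (fst_nat x)).
Proof.
apply decidable_ext with (fun g x =>
  lookup (S (fst_nat x)) (tower_table g (fst_nat x) (snd_nat x)) (fst_nat x)).
- intros g x; now apply tower_table_spec.
- apply decidable_lookup; [rec_tac | | rec_tac].
  apply recursive_rect with (s := fun g x e t =>
    table (refine g e (lookup (S (fst_nat x)) t)) (S (fst_nat x))).
  + apply recursive_table with (f := fun _ _ _ => true); rec_tac.
  + rec_tac.
  (* here [p] codes the triple of the input, the stage and the previous table *)
  + apply recursive_table with (f := fun g p => refine g (fst_nat (snd_nat p))
      (lookup (S (fst_nat (fst_nat p))) (snd_nat (snd_nat p)))); [|rec_tac].
    apply decidable_refine with (A := fun g p =>
      lookup (S (fst_nat (fst_nat (fst_nat p)))) (snd_nat (snd_nat (fst_nat p))));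
      try apply decidable_lookup; rec_tac.
Qed.

(** * Computable unbounded sets *)

Definition unbounded (A : nat -> bool) : Prop :=
  forall N, exists u, N <= u /\ A u = true.

Definition computable_pred (A : nat -> bool) : Prop := decidable false (fun _ => A).

(** Consecutive elements of [A] have opposite parities.  The value [true] of [b]
shows that thinning keeps a set unbounded, [false] that it removes infinitely
much. *)
Lemma unbounded_parity A b :
  unbounded A -> forall N, exists u, N <= u /\ A u = true /\ even_below A u = b.
Proof.
intros HA N; destruct (HA N) as (u & Hu & Au).
destruct (bool_dec (even_below A u) b) as [E | E]; [now exists u|].
assert (Hex : exists v, u < v /\ A v = true)
  by (destruct (HA (S u)) as (v & Hv & Av); now exists v).
destruct (epsilon_smallest (fun v => u < v /\ A v = true)) as (v & (Hv & Av) & Hmin);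
  [|exact Hex|].
{ intros v; destruct (lt_dec u v), (bool_dec (A v) true); tauto. }
exists v; split; [lia|]; split; [trivial|].
assert (Hconst : forall k, u + S k <= v -> even_below A (u + S k) = b).
{ intros k Hk; induction k as [|k IHk].
  - rewrite Nat.add_1_r; unfold even_below in *; simpl; rewrite Au.
    now destruct b, (fold_below xorb true A u).
  - rewrite Nat.add_succ_r; unfold even_below in *; simpl fold_below.
    rewrite IHk by lia.
    destruct (A (u + S k)) eqn:Ak; [|now destruct b].
    enough (v <= u + S k) by lia; apply Hmin; split; [lia | trivial]. }
replace v with (u + S (v - S u)) by lia; apply Hconst; lia.
Qed.

(** Changing one value at a time, computability is invariant under finite changes. *)
Lemma computable_pred_eventually A B N :
  computable_pred B -> (forall u, N <= u -> A u = B u) -> computable_pred A.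
Proof.
revert B; induction N as [|N IHN]; intros B HB HAB.
- apply decidable_ext with (2 := HB); intros _ u; rewrite HAB; auto with arith.
- apply IHN with (B := fun u => if u =? N then A N else B u).
  + unfold computable_pred in *.
    apply decidable_if; [|apply decidable_const | trivial]; rec_tac.
  + intros u Hu; destruct (Nat.eqb_spec u N) as [-> |]; [trivial|].
    apply HAB; lia.
Qed.

Lemma computable_search (P : nat -> nat -> bool) :
  decidable false (fun _ p => P (fst_nat p) (snd_nat p)) ->
  (forall x, exists y, P x y = true) ->
  exists f, computable f /\
    forall x, P x (f x) = true /\ forall y, P x y = true -> f x <= y.
Proof.
intros HP Hex.
assert (Hdec : forall x y, {P x y = true} + {P x y <> true})
  by (intros x y; apply bool_dec).
set (f := fun x => proj1_sig (epsilon_smallest _ (Hdec x) (Hex x))).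
assert (Hf : forall x, P x (f x) = true /\ forall y, P x y = true -> f x <= y)
  by (intros x; exact (proj2_sig (epsilon_smallest _ (Hdec x) (Hex x)))).
exists f; split; [|exact Hf].
apply computable_recursive, recursive_min with
  (a := fun _ p => Nat.b2n (negb (P (fst_nat p) (snd_nat p)))).
- now apply decidable_neg.
- intros _ x; rewrite fst_pair, snd_pair; now rewrite (proj1 (Hf x)).
- intros _ x y Hy; rewrite fst_pair, snd_pair.
  destruct (P x y) eqn:E; [|easy].
  apply (proj2 (Hf x)) in E; lia.
Qed.

(** * The guesses made from a dominating function *)

Section Dominating.

Variable h : nat -> nat.
Hypothesis h_dom : forall f, computable f -> dominates h f.

Lemma halting_bound e : total e ->
  exists f, computable f /\ forall u x, x <= u -> run e x (f u) <> 0.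
Proof.
intros He.
destruct (computable_search (halts_upto e)) as (f & Hf & Hfe).
- apply decidable_halts_upto; rec_tac.
- intros u; induction u as [|u [t Ht]].
  + destruct (He 0) as [t Ht]; exists t; apply forall_belowP; intros i Hi.
    replace i with 0 by lia; now apply negb_true_iff, Nat.eqb_neq.
  + destruct (He (S u)) as [t' Ht']; exists (t + t').
    unfold halts_upto in *; rewrite forall_belowP in *; intros i Hi.
    apply negb_true_iff, Nat.eqb_neq.
    destruct (Nat.eq_dec i (S u)) as [-> | Hn].
    * rewrite run_mono with (t := t'); trivial; lia.
    * specialize (Ht i ltac:(lia)); apply negb_true_iff, Nat.eqb_neq in Ht.
      rewrite run_mono with (t := t); trivial; lia.
- exists f; split; [trivial|]; intros u x Hx.
  destruct (Hfe u) as [H _]; unfold halts_upto in H; rewrite forall_belowP in H.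
  apply Nat.eqb_neq, negb_true_iff, H; lia.
Qed.

(** Since halting persists, [h] can replace the computable halting bound that it
dominates: eventually the totality test succeeds and [h u] steps reveal the value
[f u] at [u]. *)
Lemma total_eventually e : total e ->
  exists f N, computable f /\ (forall u t, run e u t <> 0 -> run e u t = f u) /\
    forall u, N <= u -> halts_upto e u (h u) = true /\ run e u (h u) = f u.
Proof.
intros He; destruct (halting_bound e He) as (c & Hc & Hce).
destruct (h_dom c Hc) as [N HN].
assert (Hrun : forall u t, run e u t <> 0 -> run e u t = run e u (c u)).
{ intros u t Ht; rewrite <- (run_mono e u t (t + c u)) by (trivial; lia).
  apply run_mono; [now apply Hce | lia]. }
exists (fun u => run e u (c u)), N; split; [|split; [exact Hrun|]].
- apply computable_recursive, recursive_run; [rec_tac.. |].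
  now apply computable_recursive.
- intros u Hu; specialize (HN u Hu); split.
  + apply forall_belowP; intros i Hi; apply negb_true_iff, Nat.eqb_neq.
    rewrite run_mono with (t := c u); trivial; apply Hce; lia.
  + apply run_mono; trivial; now apply Hce.
Qed.

Lemma partial_eventually e : ~ total e ->
  exists N, forall u t, N <= u -> halts_upto e u t = false.
Proof.
intros He; apply not_all_ex_not in He; destruct He as [x Hx]; exists x.
intros u t Hu; apply not_true_iff_false; intros H.
unfold halts_upto in H; rewrite forall_belowP in H.
specialize (H x ltac:(lia)); apply Hx; exists t.
now apply Nat.eqb_neq, negb_true_iff.
Qed.

(** With [v] the last element of [C] below [u], the next element of [C] after [v] is
at least [u], and it is a computable function of [v], hence bounded by [h v]. *)
Lemma unbounded_recent C N : computable_pred C -> unbounded C ->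
  exists M, forall u, M <= u -> exists v, N <= v < u /\ C v = true /\ u <= h v.
Proof.
intros HC Hinf.
destruct (computable_search (fun s y => negb (y <=? s) && C y)) as (f & Hf & Hnext).
- apply decidable_op; [rec_tac|].
  apply (recursive_comp false (fun _ u => Nat.b2n (C u)) (fun _ p => snd_nat p));
    [trivial | rec_tac].
- intros s; destruct (Hinf (S s)) as (y & Hy & Cy); exists y.
  now rewrite Cy, (proj2 (Nat.leb_gt y s)).
- destruct (h_dom f Hf) as [K HK].
  destruct (Hinf (N + K)) as (v0 & Hv0 & Cv0).
  exists (S v0); intros u Hu.
  (* the last element of [C] below [u], by induction on [u] from [v0] on *)
  assert (Hlast : forall k, S v0 + k = u -> exists v,
    N + K <= v < u /\ C v = true /\ forall w, v < w < u -> C w = false).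
  { intros k; clear Hu; revert u; induction k as [|k IHk]; intros u Hu.
    - exists v0; split; [lia|]; split; [trivial|]; intros w Hw; lia.
    - destruct (IHk (S v0 + k) eq_refl) as (v & Hv & Cv & Hw).
      destruct (C (S v0 + k)) eqn:E.
      + exists (S v0 + k); split; [lia|]; split; [trivial|]; intros w Hw'; lia.
      + exists v; split; [lia|]; split; [trivial|]; intros w Hw'.
        destruct (Nat.eq_dec w (S v0 + k)) as [-> |]; [trivial|]; apply Hw; lia. }
  destruct (Hlast (u - S v0)) as (v & Hv & Cv & Hw); [lia|].
  exists v; split; [lia|]; split; [trivial|].
  destruct (Hnext v) as [Hfv _]; apply andb_true_iff in Hfv.
  destruct Hfv as [Hgt Cf]; apply negb_true_iff, Nat.leb_gt in Hgt.
  specialize (HK v ltac:(lia)).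
  destruct (Nat.le_gt_cases u (f v)) as [Hle | Hlt]; [lia|].
  rewrite Hw in Cf by lia; discriminate.
Qed.

Lemma bounded_image N : exists M, forall v, v < N -> h v < M.
Proof.
induction N as [|N [M HM]]; [exists 0; lia|].
exists (S (M + h N)); intros v Hv.
destruct (Nat.eq_dec v N) as [-> |]; [lia|].
specialize (HM v ltac:(lia)); lia.
Qed.

(** For each [e] both guesses converge, to answers that depend on [e] and [A]; with
the limit answers in place of the guesses, [refine] becomes a computable set [D].
The answer [b] on whether accepted elements are infinitely many is chosen so that
[D] is unbounded, and it is also the side of the [e]-th set on which [refine]
eventually lies. *)
Lemma refine_eventually e A :
  computable_pred A -> unbounded A ->
  exists D N, computable_pred D /\ unbounded D /\
    (forall u, N <= u -> refine h e A u = D u) /\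
    (total e -> exists b, forall u t, N <= u -> refine h e A u = true ->
       run e u t <> 0 -> accepts e u t = b).
Proof.
intros HA Hinf.
assert (HB : computable_pred (thin A)).
{ apply decidable_thin with (A := fun _ _ => A); [|rec_tac].
  apply (recursive_comp false (fun _ u => Nat.b2n (A u)) (fun _ p => snd_nat p));
    [trivial | rec_tac]. }
assert (Binf : unbounded (thin A)).
{ intros N; destruct (unbounded_parity A true Hinf N) as (u & Hu & Au & Eu).
  exists u; unfold thin; now rewrite Au, Eu. }
destruct (classic (total e)) as [He | He].
- destruct (total_eventually e He) as (f & N & Hf & Hval & Hev).
  apply computable_recursive in Hf.
  (* 2 stands for the value 1, see [run] *)
  set (C := fun u => thin A u && (f u =? 2)).
  assert (HC : computable_pred C).
  { apply decidable_op; [trivial|]; rec_tac. }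
  assert (Hguess : exists b M,
    (forall u, M <= u -> recently_accepted h e A u = b) /\
    unbounded (fun u => thin A u && eqb (f u =? 2) b)).
  { destruct (classic (unbounded C)) as [Cinf | Cfin].
    - destruct (unbounded_recent C N HC Cinf) as [M HM]; exists true, M; split.
      + intros u Hu; destruct (HM u Hu) as (v & Hv & Cv & Hle).
        apply exists_belowP; exists v; split; [lia|].
        unfold accepts; rewrite (proj2 (Hev v ltac:(lia))).
        unfold C in Cv; rewrite Cv; now apply Nat.leb_le.
      + intros K; destruct (Cinf K) as (u & Hu & Cu); exists u; split; [trivial|].
        unfold C in Cu; now destruct (thin A u), (f u =? 2).
    - apply not_all_ex_not in Cfin; destruct Cfin as [K HK].
      assert (CK : forall u, K <= u -> C u = false).
      { intros u Hu; apply not_true_iff_false; intros Cu; apply HK; now exists u. }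
      destruct (bounded_image (N + K)) as [M HM]; exists false, M; split.
      + intros u Hu; apply not_true_iff_false; intros H.
        apply exists_belowP in H; destruct H as (v & Hv & H).
        apply andb_true_iff in H; destruct H as [H Hle]; apply Nat.leb_le in Hle.
        destruct (Nat.lt_ge_cases v (N + K)) as [Hlt | Hge];
          [specialize (HM v Hlt); lia|].
        unfold accepts in H; rewrite (proj2 (Hev v ltac:(lia))) in H.
        specialize (CK v ltac:(lia)); unfold C in CK; congruence.
      + intros L; destruct (Binf (L + K)) as (u & Hu & Bu); exists u.
        split; [lia|]; specialize (CK u ltac:(lia)); unfold C in CK.
        rewrite Bu in *; simpl in CK; now rewrite CK. }
  destruct Hguess as (b & M & Hb & Dinf).
  exists (fun u => thin A u && eqb (f u =? 2) b), (N + M).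
  assert (HD : forall u, N + M <= u ->
    refine h e A u = thin A u && eqb (f u =? 2) b).
  { intros u Hu; unfold refine, accepts.
    destruct (Hev u) as [-> ->]; [lia|]; now rewrite Hb by lia. }
  repeat split; trivial.
  + apply decidable_op; [trivial|]; rec_tac.
  + intros _; exists b; intros u t Hu Fu Ht.
    rewrite HD in Fu by trivial; apply andb_true_iff in Fu; destruct Fu as [_ Fu].
    unfold accepts; rewrite Hval by trivial; now apply eqb_prop.
- destruct (partial_eventually e He) as [N HN].
  exists (thin A), N; repeat split; trivial; [|easy].
  intros u Hu; unfold refine; rewrite HN by trivial; apply andb_true_r.
Qed.

Lemma tower_computable_unbounded n :
  computable_pred (tower h n) /\ unbounded (tower h n).
Proof.
induction n as [|e [Hc Hinf]]; simpl.
- split; [apply decidable_const | intros N; now exists N].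
- destruct (refine_eventually e _ Hc Hinf) as (D & N & HD & Dinf & Heq & _).
  split; [now apply computable_pred_eventually with D N|].
  intros M; destruct (Dinf (M + N)) as (u & Hu & Du); exists u.
  rewrite Heq by lia; split; [lia | trivial].
Qed.

End Dominating.

(** * The ultrafilter base *)

Lemma bounded_Finite (X : Ensemble nat) N :
  (forall u, In nat X u -> u < N) -> Finite nat X.
Proof.
revert X; induction N as [|N IHN]; intros X HX.
- apply Finite_downward_closed with (Empty_set nat); [constructor|].
  intros u Hu; specialize (HX u Hu); lia.
- apply Finite_downward_closed with (Add nat (Subtract nat X N) N).
  + apply Add_preserves_Finite, IHN; intros u [Hu Hn].
    specialize (HX u Hu).
    enough (u <> N) by lia; intros ->; apply Hn; constructor.
  + intros u Hu; destruct (Nat.eq_dec u N) as [-> | Hn].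
    * right; now constructor.
    * left; split; [trivial|]; intros HS; apply Hn; now destruct HS.
Qed.

Lemma Finite_bounded (X : Ensemble nat) :
  Finite nat X -> exists N, forall u, In nat X u -> u < N.
Proof.
induction 1 as [|X _ [N HN] x _]; [exists 0; intros u []|].
exists (S (N + x)); intros u [v Hv | v []]; [specialize (HN v Hv)|]; lia.
Qed.

Definition tower_set (h : nat -> nat) : Ensemble nat :=
  fun x => tower h (snd_nat x) (fst_nat x) = true.

Lemma column_tower h n u : In nat (column (tower_set h) n) u <-> tower h n u = true.
Proof.
unfold In, column, tower_set, In; now rewrite fst_pair, snd_pair.
Qed.

Lemma char_fun_bool (X : Ensemble nat) (A : nat -> bool) :
  (forall u, In nat X u <-> A u = true) -> char_fun X (fun u => Nat.b2n (A u)).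
Proof.
intros H u; rewrite H; destruct (A u); [left | right]; auto.
Qed.

Lemma tower_ultrafilter_base h : DomFcn h -> ultrafilter_base (tower_set h).
Proof.
intros [Hdom _].
assert (Htower := tower_computable_unbounded h Hdom).
split; [|split; [|split]].
- intros n; exists (fun u => Nat.b2n (tower h n u)); split.
  + apply computable_recursive, Htower.
  + apply char_fun_bool, column_tower.
- split; [easy|]; intros u _; now apply column_tower.
- intros n; destruct (Htower n) as [_ Hinf]; split.
  + apply bounded_Finite with 0; intros u [Hu Hn]; exfalso; apply Hn.
    apply (proj1 (column_tower _ _ _)) in Hu; apply column_tower; cbn [tower] in Hu.
    unfold refine, thin in Hu; rewrite !andb_true_iff in Hu; tauto.
  + intros Hfin; apply Finite_bounded in Hfin; destruct Hfin as [N HN].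
    destruct (unbounded_parity _ false Hinf N) as (u & Hu & Au & Eu).
    enough (u < N) by lia; apply HN; split; [now apply column_tower|].
    intros H; apply (proj1 (column_tower _ _ _)) in H; cbn [tower] in H.
    unfold refine, thin in H; now rewrite Au, Eu in H.
- intros R (f & Hf & HR).
  destruct (run_complete f Hf) as [e He].
  destruct (Htower e) as [Hc Hinf].
  destruct (refine_eventually h Hdom e _ Hc Hinf) as (_ & N & _ & _ & _ & Hdec).
  destruct Hdec as [b Hb].
  { intros x; destruct (He x) as [t Ht]; exists t; now rewrite Ht. }
  exists (S e).
  assert (Hf1 : forall u, N <= u -> In nat (column (tower_set h) (S e)) u ->
    (f u =? 1) = b).
  { intros u Hu Fu; apply (proj1 (column_tower _ _ _)) in Fu; destruct (He u) as [t Ht].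
    rewrite <- (Hb u t Hu Fu); unfold accepts; now rewrite Ht. }
  destruct b; [left | right]; apply bounded_Finite with N; intros u [Fu Hn];
    apply Nat.nle_gt; intros Hu; specialize (Hf1 u Hu Fu); apply Hn.
  + apply Nat.eqb_eq in Hf1; destruct (HR u) as [[H _] | [_ H]]; [trivial | lia].
  + apply Nat.eqb_neq in Hf1; destruct (HR u) as [[_ H] | [H _]]; [lia | trivial].
Qed.

Theorem theorem3p8 : medvedev_le UltrafilterBases DomFcn.
Proof.
destruct decidable_tower as (c & _ & Hc).
exists c; intros h Hh.
exists (fun x => Nat.b2n (tower h (snd_nat x) (fst_nat x))); split; [apply Hc|].
exists (tower_set h); split; [now apply tower_ultrafilter_base|].
now apply char_fun_bool with (A := fun x => tower h (snd_nat x) (fst_nat x)).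
Qed.
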